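(* Let $0<|q|<1$, $0<|p|<1$, $|x|<1$. (I) Let $a,b,c,d\in\mathbb{C}$ with $p^{c}\neq p^{-n}$ and $q^{d}\ne q^{-n}$ for all integers $n\ge 0$. If $|y|<|q|$ and $q^{d-1}\neq 1$, then $$(1-q^{a})\Psi_{1}\Big(q^{a+1},p^{b};p^{c},q^{d};q,p,x,\frac{y}{q}\Big)+q^{a+1-d}\Psi_{1}(q^{a},p^{b};p^{c},q^{d};q,p,x,y)$$ $$=\Psi_{1}\Big(q^{a},p^{b};p^{c},q^{d};q,p,x,\frac{y}{q}\Big)+q^{a+1-d}(1-q^{d-1})\Psi_{1}(q^{a},p^{b};p^{c},q^{d-1};q,p,x,y).$$ If $|y|<1$ and $p^{c-1}\ne 1$, then $$(1-p^{b})\Psi_{1}(q^{a},p^{b+1};p^{c},q^{d};q,p,x,y)=p^{b+1-c}(1-p^{c-1})\Psi_{1}(q^{a},p^{b};p^{c-1},q^{d};q,p,x,y)+(1-p^{b+1-c})\Psi_{1}(q^{a},p^{b};p^{c},q^{d};q,p,x,y).$$ (II) Let $a,b,c\in\mathbb{C}$ with $p^{b}\neq p^{-n}$ and $q^{c}\ne q^{-n}$ for all integers $n\ge 0$. If $|y|<|q|$ and $q^{c-1}\neq 1$, then $$(1-q^{a})\Psi_{2}\Big(q^{a+1};p^{b},q^{c};q,p,x,\frac{y}{q}\Big)+q^{a+1-c}\Psi_{2}(q^{a};p^{b},q^{c};q,p,x,y)$$ $$=\Psi_{2}\Big(q^{a};p^{b},q^{c};q,p,x,\frac{y}{q}\B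ig)+q^{a+1-c}(1-q^{c-1})\Psi_{2}(q^{a};p^{b},q^{c-1};q,p,x,y).$$
   Context: $q,p\in\mathbb{C}$ are two independent bases with $0<|q|<1$, $0<|p|<1$; logarithms of $q$ and $p$ are fixed so that $q^{a}=e^{a\log q}$, $p^{b}=e^{b\log p}$ for complex exponents. The $q$-shifted factorial is $(A;q)_{0}=1$, $(A;q)_{k}=\prod_{r=0}^{k-1}(1-Aq^{r})$ for $k\ge1$ (similarly with base $p$). The bibasic Humbert functions are, for $|x|,|y|<1$ and whenever no denominator factor vanishes, $$\Psi_{1}(q^{a},p^{b};p^{c},q^{d};q,p,x,y)=\sum_{\ell,k=0}^{\infty}\frac{(q^{a};q)_{k+\ell}(p^{b};p)_{\ell}}{(p^{c};p)_{\ell}(q^{d};q)_{k}(q;q)_{k}(p;p)_{\ell}}x^{k}y^{\ell},$$ $$\Psi_{2}(q^{a};p^{b},q^{c};q,p,x,y)=\sum_{\ell,k=0}^{\infty}\frac{(q^{a};q)_{k+\ell}}{(p^{b};p)_{\ell}(q^{c};q)_{k}(q;q)_{k}(p;p)_{\ell}}x^{k}y^{\ell}.$$ *)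

(* Defs.v *)
From Stdlib Require Import Reals.
From Coquelicot Require Import Coquelicot.

Local Open Scope C_scope.

Definition Cexp (z : C) : C :=
  (exp (Re z) * cos (Im z), exp (Re z) * sin (Im z))%R.

(* [cpower lq a] is q^a, where [lq] is the chosen logarithm of q. *)
Definition cpower (lq a : C) : C := Cexp (a * lq).

Fixpoint qpoch (A q : C) (k : nat) : C :=
  match k with
  | O => 1
  | S k' => qpoch A q k' * (1 - A * q ^ k')
  end.

(* The sum of a double series is the limit of its rectangular partial sums
   over l <= N and k <= M, as N and M tend to infinity independently. *)
Definition is_double_series (u : nat -> nat -> C) (s : C) : Prop :=
  filterlim
    (fun NM : nat * nat =>
       sum_n (fun l => sum_n (fun k => u l k) (snd NM)) (fst NM))
    (filter_prod eventually eventually) (locally s).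

(* [iota] selects the sum when the series converges, and is a meaningless
   default value otherwise. *)
Definition double_series (u : nat -> nat -> C) : C :=
  iota (T := C_CompleteNormedModule) (is_double_series u).

(* As in the usual notation, the parameters of the Humbert functions are the
   powers themselves: A = q^a, B = p^b, G = p^c, D = q^d for Psi1, and
   A = q^a, B = p^b, G = q^c for Psi2. *)
Definition Psi1 (A B G D q p x y : C) : C :=
  double_series (fun l k =>
    (qpoch A q (k + l) * qpoch B p l)
    / (qpoch G p l * qpoch D q k * qpoch q q k * qpoch p p l)
    * x ^ k * y ^ l).

Definition Psi2 (A B G q p x y : C) : C :=
  double_series (fun l k =>
    qpoch A q (k + l)
    / (qpoch B p l * qpoch G q k * qpoch q q k * qpoch p p l)
    * x ^ k * y ^ l).

(* Main.v *)
(* For |q| < 1 the products (A;q)_n and, when no factor vanishes, 1/(D;q)_n are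
   bounded in n, so both Humbert series are dominated by K |x|^k |y|^l and may be
   combined linearly.  Each relation then holds term by term, because
   (1 - A) (Aq;q)_n = (A;q)_n (1 - A q^n). *)

Require Import Defs.
From Stdlib Require Import Reals Lra Lia.
From Coquelicot Require Import Coquelicot.
Local Open Scope C_scope.

(** * Convergence of dominated double series *)

Lemma norm_sum_n_diff_le {K : AbsRing} {V : NormedModule K}
  (a : nat -> V) (b : nat -> R) (N M : nat) :
  (forall n, norm (a n) <= b n)%R -> (N <= M)%nat ->
  (norm (minus (sum_n a M) (sum_n a N)) <= sum_n b M - sum_n b N)%R.
Proof.
intros hab hNM; induction hNM as [|M hNM IH].
- rewrite minus_eq_zero, Rminus_diag; right; apply norm_zero.
- rewrite !sum_Sn.
  replace (minus (plus (sum_n a M) (a (S M))) (sum_n a N))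
    with (plus (minus (sum_n a M) (sum_n a N)) (a (S M))).
  + eapply Rle_trans; [apply norm_triangle|].
    specialize (hab (S M)); unfold plus; simpl; lra.
  + unfold minus; rewrite <- !plus_assoc; f_equal; apply plus_comm.
Qed.

Lemma norm_sum_n_le {K : AbsRing} {V : NormedModule K}
  (a : nat -> V) (b : nat -> R) (N : nat) :
  (forall n, norm (a n) <= b n)%R -> (norm (sum_n a N) <= sum_n b N)%R.
Proof.
intros hab; eapply Rle_trans; [apply norm_sum_n_m|].
now apply sum_n_m_le.
Qed.

(** The larger rectangle is reached in two moves, first adding columns and then adding rows, and
    each move is a difference of single sums. *)
Lemma norm_rect_sum_diff_le (u : nat -> nat -> C) (w : nat -> nat -> R)
  (N M N' M' : nat) :
  (forall l k, Cmod (u l k) <= w l k)%R -> (N <= N')%nat -> (M <= M')%nat ->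
  (Cmod (minus (sum_n (fun l => sum_n (fun k => u l k) M') N')
               (sum_n (fun l => sum_n (fun k => u l k) M) N))
   <= sum_n (fun l => sum_n (fun k => w l k) M') N'
      - sum_n (fun l => sum_n (fun k => w l k) M) N)%R.
Proof.
intros huw hN hM.
set (S1 := sum_n (fun l => sum_n (fun k => u l k) M') N).
rewrite (minus_trans S1).
eapply Rle_trans; [apply Cmod_triangle|].
assert (h1 := norm_sum_n_diff_le (fun l => sum_n (fun k => u l k) M')
  (fun l => sum_n (fun k => w l k) M') N N'
  (fun l => norm_sum_n_le (u l) (w l) M' (huw l)) hN).
(* Adding columns requires the outer sum to run over [k]; the order of summation is exchanged back
   afterwards. *)
assert (h2 := norm_sum_n_diff_le (fun k => sum_n (fun l => u l k) N)
  (fun k => sum_n (fun l => w l k) N) M M'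
  (fun k => norm_sum_n_le (fun l => u l k) (fun l => w l k) N
              (fun l => huw l k)) hM).
rewrite <- !(sum_n_switch (fun l k => u l k)), <- !(sum_n_switch (fun l k => w l k)) in h2.
eapply Rle_trans; [exact (Rplus_le_compat _ _ _ _ h1 h2)|right; ring].
Qed.

(** Cauchy criterion: the rectangular sums of [w] converge, hence are Cauchy, and their increments
    dominate those of [u]. *)
Lemma ex_double_series_le (u : nat -> nat -> C) (w : nat -> nat -> R) (W : R) :
  (forall l k, Cmod (u l k) <= w l k)%R ->
  filterlim
    (fun NM : nat * nat => sum_n (fun l => sum_n (fun k => w l k) (snd NM)) (fst NM))
    (filter_prod eventually eventually) (locally W) ->
  exists s, is_double_series u s.
Proof.
intros huw hW.
apply (filterlim_locally_cauchy (U := C_CompleteNormedModule)); intros eps.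
assert (heps : (0 < eps / 2)%R) by (destruct eps; simpl; lra).
destruct (proj2 (filterlim_locally_cauchy _) (ex_intro _ W hW) (mkposreal _ heps))
  as [P [[Q Q' [N0 hN0] [M0 hM0] hP] hcau]].
exists (fun NM => N0 <= fst NM /\ M0 <= snd NM)%nat; split.
{ exists (fun N => N0 <= N)%nat (fun M => M0 <= M)%nat; [now exists N0|now exists M0|].
  intros N M hN hM; now split. }
(* Two large rectangles need not be nested, so each is compared with the rectangle [N0], [M0] inside
   both; hence the [eps / 2]. *)
assert (hclose : forall N M, (N0 <= N)%nat -> (M0 <= M)%nat ->
  (Cmod (minus (sum_n (fun l => sum_n (fun k => u l k) M) N)
               (sum_n (fun l => sum_n (fun k => u l k) M0) N0)) < eps / 2)%R).
{ intros N M hN hM.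
  eapply Rle_lt_trans; [apply (norm_rect_sum_diff_le u w); assumption|].
  assert (hb := hcau (N0, M0) (N, M)
    (hP _ _ (hN0 _ (Nat.le_refl _)) (hM0 _ (Nat.le_refl _)))
    (hP _ _ (hN0 _ hN) (hM0 _ hM))).
  eapply Rle_lt_trans; [apply Rle_abs|exact hb]. }
intros [N M] [N' M'] [hN hM] [hN' hM']; simpl in *.
apply C_NormedModule_mixin_compat1.
rewrite (minus_trans (sum_n (fun l => sum_n (fun k => u l k) M0) N0)).
eapply Rle_lt_trans; [apply Cmod_triangle|].
assert (h1 := hclose _ _ hN hM); assert (h2 := hclose _ _ hN' hM').
rewrite <- Cmod_opp in h1.
change Copp with (@opp C_AbelianGroup) in h1.
rewrite opp_minus in h1.
lra.
Qed.

Lemma ex_double_series_geom (u : nat -> nat -> C) (K r s : R) :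
  (0 <= r < 1)%R -> (0 <= s < 1)%R ->
  (forall l k, Cmod (u l k) <= K * r ^ k * s ^ l)%R ->
  exists S, is_double_series u S.
Proof.
intros hr hs hu.
assert (hgr := is_series_geom r ltac:(rewrite Rabs_pos_eq; lra)).
assert (hgs := is_series_geom s ltac:(rewrite Rabs_pos_eq; lra)).
apply (ex_double_series_le u (fun l k => K * r ^ k * s ^ l)%R
         (K * (/ (1 - s) * / (1 - r)))%R hu).
(* The rectangular sums of the majorant factor into two geometric sums, each depending on one index
   only, so the limit is the product of their limits. *)
apply (filterlim_ext (fun NM : nat * nat =>
  scal K (mult (sum_n (fun l => s ^ l)%R (fst NM)) (sum_n (fun k => r ^ k)%R (snd NM))))).
{ intros [N M].
  change (@mult R_Ring K (@mult R_Ring (@sum_n R_Ring (fun l => s ^ l)%R N)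
                                       (@sum_n R_Ring (fun k => r ^ k)%R M))
    = @sum_n R_Ring (fun l => @sum_n R_Ring (fun k => K * r ^ k * s ^ l)%R M) N).
  rewrite <- sum_n_mult_r, <- sum_n_mult_l.
  apply sum_n_ext; intros l.
  rewrite <- sum_n_mult_l, <- sum_n_mult_l.
  apply sum_n_ext; intros k; unfold mult; simpl; ring. }
eapply filterlim_comp; [|apply (filterlim_scal_r (V := R_NormedModule))].
eapply filterlim_comp_2; [| |apply (filterlim_mult (K := R_AbsRing))].
- eapply filterlim_comp; [apply filterlim_fst|exact hgs].
- eapply filterlim_comp; [apply filterlim_snd|exact hgr].
Qed.

(** * Uniqueness and linearity of double sums *)

Lemma is_double_series_unique (u : nat -> nat -> C) (s t : C) :
  is_double_series u s -> is_double_series u t -> s = t.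
Proof.
exact (filterlim_locally_unique (V := C_NormedModule) _ s t).
Qed.

Lemma double_series_correct (u : nat -> nat -> C) :
  (exists s, is_double_series u s) -> is_double_series u (double_series u).
Proof.
intros [s hs].
apply (iota_correct (V := C_CompleteNormedModule) (is_double_series u)); exists s; split; [exact hs|].
intros t ht; now apply (is_double_series_unique u).
Qed.

Lemma is_double_series_ext (u v : nat -> nat -> C) (s : C) :
  (forall l k, u l k = v l k) -> is_double_series u s -> is_double_series v s.
Proof.
intros huv; apply filterlim_ext; intros [N M].
apply sum_n_ext; intros l; apply sum_n_ext; intros k; apply huv.
Qed.

(** Two terms suffice: each side of a contiguous relation combines at most two series. *)
Lemma is_double_series_lincomb (u v : nat -> nat -> C) (a b s t : C) :
  is_double_series u s -> is_double_series v t ->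
  is_double_series (fun l k => a * u l k + b * v l k) (a * s + b * t).
Proof.
intros hu hv; unfold is_double_series.
apply (filterlim_ext (fun NM : nat * nat =>
  plus (scal a (sum_n (fun l => sum_n (fun k => u l k) (snd NM)) (fst NM)))
       (scal b (sum_n (fun l => sum_n (fun k => v l k) (snd NM)) (fst NM))))).
{ intros [N M].
  change (@plus C_Ring
      (@mult C_Ring a (@sum_n C_Ring (fun l => @sum_n C_Ring (u l) M) N))
      (@mult C_Ring b (@sum_n C_Ring (fun l => @sum_n C_Ring (v l) M) N))
    = @sum_n C_Ring (fun l => @sum_n C_Ring (fun k =>
        @plus C_Ring (@mult C_Ring a (u l k)) (@mult C_Ring b (v l k))) M) N).
  rewrite <- !sum_n_mult_l, <- sum_n_plus.
  apply sum_n_ext; intros l.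
  rewrite <- !sum_n_mult_l, <- sum_n_plus.
  reflexivity. }
eapply filterlim_comp_2; [| |apply (filterlim_plus (V := C_NormedModule))].
- eapply filterlim_comp; [exact hu|apply (filterlim_scal_r (V := C_NormedModule))].
- eapply filterlim_comp; [exact hv|apply (filterlim_scal_r (V := C_NormedModule))].
Qed.

(** * Bounds for shifted factorials and their reciprocals *)

(** Since [1 + t <= exp t], the product of the factors [1 + M * r ^ j] is at most the exponential of
    a geometric sum. *)
Lemma geom_growth_bounded (u : nat -> R) (M r : R) :
  (0 <= M)%R -> (0 <= r < 1)%R -> (forall n, 0 <= u n)%R ->
  (forall n, u (S n) <= u n * (1 + M * r ^ n))%R ->
  forall n, (u n <= u O * exp (M / (1 - r)))%R.
Proof.
intros hM hr hu hS.
(* The final bound does not propagate by induction; the partial geometric sum does, as its increment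
   is exactly [M * r ^ n]. *)
assert (h : forall n, (u n <= u O * exp (M * (1 - r ^ n) / (1 - r)))%R).
{ induction n as [|n IH].
  - replace (M * (1 - r ^ 0) / (1 - r))%R with 0%R by (simpl; field; lra).
    rewrite exp_0; lra.
  - replace (M * (1 - r ^ S n) / (1 - r))%R
      with (M * (1 - r ^ n) / (1 - r) + M * r ^ n)%R by (simpl; field; lra).
    rewrite exp_plus, <- Rmult_assoc.
    eapply Rle_trans; [apply hS|].
    assert (0 <= r ^ n)%R by (apply pow_le; lra).
    apply Rmult_le_compat; [apply hu|nra|exact IH|apply exp_ineq1_le]. }
intros n; eapply Rle_trans; [apply h|].
apply Rmult_le_compat_l; [apply hu|].
assert (0 <= r ^ n)%R by (apply pow_le; lra).
assert (0 < / (1 - r))%R by (apply Rinv_0_lt_compat; lra).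
destruct (Rle_lt_or_eq_dec (M * (1 - r ^ n) / (1 - r)) (M / (1 - r))) as [hlt|heq].
- unfold Rdiv; apply Rmult_le_compat_r; nra.
- left; now apply exp_increasing.
- rewrite heq; lra.
Qed.

Lemma qpoch_bounded (A q : C) :
  (Cmod q < 1)%R -> exists K, forall n, (Cmod (qpoch A q n) <= K)%R.
Proof.
intros hq; assert (hq0 := Cmod_ge_0 q); assert (hA := Cmod_ge_0 A).
eexists; apply (geom_growth_bounded (fun n => Cmod (qpoch A q n)) (Cmod A) (Cmod q));
  [lra|lra|intros; apply Cmod_ge_0|].
intros n; simpl; rewrite Cmod_mult.
apply Rmult_le_compat_l; [apply Cmod_ge_0|].
unfold Cminus; eapply Rle_trans; [apply Cmod_triangle|].
rewrite Cmod_opp, Cmod_1, Cmod_mult, Cmod_pow; lra.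
Qed.

(** As [D * q ^ n] tends to 0, all but finitely many factors have modulus at least 1/2; the
    remaining ones are nonzero and have a positive minimum. *)
Lemma one_minus_geom_bounded_below (D q : C) :
  (Cmod q < 1)%R -> (forall n, 1 - D * q ^ n <> 0) ->
  exists m, (0 < m)%R /\ forall n, (m <= Cmod (1 - D * q ^ n))%R.
Proof.
intros hq hD; assert (hq0 := Cmod_ge_0 q).
assert (hfin : forall N, exists m, (0 < m)%R /\
  forall n, (n < N)%nat -> (m <= Cmod (1 - D * q ^ n))%R).
{ induction N as [|N [m [hm hN]]].
  - exists 1%R; split; [lra|intros n hn; lia].
  - exists (Rmin m (Cmod (1 - D * q ^ N))); split.
    + apply Rmin_glb_lt; [exact hm|now apply Cmod_gt_0].
    + intros n hn; destruct (Nat.eq_dec n N) as [->|hne]; [apply Rmin_r|].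
      eapply Rle_trans; [apply Rmin_l|apply hN; lia]. }
assert (hlim : is_lim_seq (fun n => (Cmod D * Cmod q ^ n)%R) 0%R).
{ replace (Finite 0) with (Rbar_mult (Cmod D) 0%R) by (simpl; f_equal; ring).
  apply is_lim_seq_scal_l, is_lim_seq_geom; rewrite Rabs_pos_eq; lra. }
apply is_lim_seq_spec in hlim.
destruct (hlim (mkposreal (/ 2) ltac:(lra))) as [N hN]; simpl in hN.
destruct (hfin N) as [m [hm hmN]].
exists (Rmin m (/ 2)); split; [apply Rmin_glb_lt; lra|].
intros n; destruct (Nat.lt_ge_cases n N) as [hn|hn].
- eapply Rle_trans; [apply Rmin_l|now apply hmN].
- eapply Rle_trans; [apply Rmin_r|].
  assert (hb := hN n hn); rewrite Rminus_0_r in hb.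
  apply Rabs_def2 in hb; destruct hb as [hb _].
  assert (ht := Cmod_triangle (1 - D * q ^ n) (D * q ^ n)).
  replace (1 - D * q ^ n + D * q ^ n) with (1 : C) in ht by ring.
  rewrite Cmod_1, (Cmod_mult D), Cmod_pow in ht; lra.
Qed.

Lemma qpoch_neq_0 (D q : C) :
  (forall n, 1 - D * q ^ n <> 0) -> forall n, qpoch D q n <> 0.
Proof.
intros hD; induction n as [|n IH]; simpl.
- exact C1_nz.
- now apply Cmult_neq_0.
Qed.

(** Writing [1 / (1 - t) = 1 + t / (1 - t)] with [t = D * q ^ n], the lower bound [m] on the factors
    gives growth by at most [1 + M * r ^ n] with [M = Cmod D / m] and [r = Cmod q]. *)
Lemma qpoch_inv_bounded (D q : C) :
  (Cmod q < 1)%R -> (forall n, 1 - D * q ^ n <> 0) ->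
  exists K, forall n, (Cmod (/ qpoch D q n) <= K)%R.
Proof.
intros hq hD; assert (hq0 := Cmod_ge_0 q); assert (hD0 := Cmod_ge_0 D).
destruct (one_minus_geom_bounded_below D q hq hD) as [m [hm hmn]].
assert (hm' : (0 < / m)%R) by now apply Rinv_0_lt_compat.
eexists; apply (geom_growth_bounded (fun n => Cmod (/ qpoch D q n))
  (Cmod D * / m) (Cmod q)); [nra|lra|intros; apply Cmod_ge_0|].
intros n; simpl.
assert (hn := qpoch_neq_0 D q hD n); specialize (hD n).
replace (/ (qpoch D q n * (1 - D * q ^ n)))
  with (/ qpoch D q n * (1 + D * q ^ n * / (1 - D * q ^ n))) by (field; auto).
rewrite Cmod_mult.
apply Rmult_le_compat_l; [apply Cmod_ge_0|].
eapply Rle_trans; [apply Cmod_triangle|].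
rewrite Cmod_1, !Cmod_mult, Cmod_pow, Cmod_inv by exact hD.
assert (/ Cmod (1 - D * q ^ n) <= / m)%R by (apply Rinv_le_contravar; auto).
assert (0 <= Cmod q ^ n)%R by (apply pow_le; lra).
assert (0 <= Cmod D * Cmod q ^ n)%R by nra.
nra.
Qed.

(** Keeps the denominators [(q;q)_k] and [(p;p)_l] nonzero: [q ^ S n = 1] contradicts
    [|q|^(n+1) <= |q| < 1]. *)
Lemma one_minus_pow_neq_0 (q : C) (n : nat) :
  (Cmod q < 1)%R -> 1 - q * q ^ n <> 0.
Proof.
intros hq h; assert (hq0 := Cmod_ge_0 q).
assert (h1 : q ^ S n = 1).
{ simpl; replace (q * q ^ n) with (1 - (1 - q * q ^ n)) by ring; rewrite h; ring. }
apply (f_equal Cmod) in h1; rewrite Cmod_pow, Cmod_1 in h1.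
assert (hle : (Cmod q ^ n <= 1)%R).
{ rewrite <- (pow1 n); apply pow_incr; lra. }
simpl in h1; assert (0 <= Cmod q ^ n)%R by (apply pow_le; lra); nra.
Qed.

(** * Convergence of the first Humbert series *)

Lemma Psi1_correct (A B G D q p x y : C) :
  (Cmod q < 1)%R -> (Cmod p < 1)%R -> (Cmod x < 1)%R -> (Cmod y < 1)%R ->
  (forall n, 1 - G * p ^ n <> 0) -> (forall n, 1 - D * q ^ n <> 0) ->
  is_double_series (fun l k =>
    (qpoch A q (k + l) * qpoch B p l)
    / (qpoch G p l * qpoch D q k * qpoch q q k * qpoch p p l)
    * x ^ k * y ^ l) (Psi1 A B G D q p x y).
Proof.
intros hq hp hx hy hG hD.
apply double_series_correct.
assert (hqq := fun n => one_minus_pow_neq_0 q n hq).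
assert (hpp := fun n => one_minus_pow_neq_0 p n hp).
destruct (qpoch_bounded A q hq) as [KA hA].
destruct (qpoch_bounded B p hp) as [KB hB].
destruct (qpoch_inv_bounded G p hp hG) as [KG hKG].
destruct (qpoch_inv_bounded D q hq hD) as [KD hKD].
destruct (qpoch_inv_bounded q q hq hqq) as [Kq hKq].
destruct (qpoch_inv_bounded p p hp hpp) as [Kp hKp].
assert (hx0 := Cmod_ge_0 x); assert (hy0 := Cmod_ge_0 y).
apply (ex_double_series_geom _ (KA * KB * (KG * KD * Kq * Kp)) (Cmod x) (Cmod y));
  [lra|lra|].
intros l k.
(* Regrouping as a product of reciprocals lets the six bounds apply factor by factor; the one for
   [qpoch A q] is uniform in its index, so [k + l] causes no coupling. *)
replace (qpoch A q (k + l) * qpoch B p l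
    / (qpoch G p l * qpoch D q k * qpoch q q k * qpoch p p l))
  with (qpoch A q (k + l) * qpoch B p l
    * (/ qpoch G p l * / qpoch D q k * / qpoch q q k * / qpoch p p l))
  by (field; repeat split; now apply qpoch_neq_0).
rewrite (Cmod_mult _ (y ^ l)), (Cmod_mult _ (x ^ k)), !Cmod_pow.
apply Rmult_le_compat_r; [now apply pow_le|].
apply Rmult_le_compat_r; [now apply pow_le|].
rewrite !Cmod_mult.
repeat (apply Rmult_le_compat || apply Rmult_le_pos || apply Cmod_ge_0); auto.
Qed.

(** * Contiguous relations in terms of the parameters *)

(** Both sides are [(A;q)_(n+1)], with the first or the last factor split off. *)
Lemma qpoch_shift (A q : C) (n : nat) :
  (1 - A) * qpoch (A * q) q n = qpoch A q n * (1 - A * q ^ n).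
Proof.
induction n as [|n IH]; simpl; [ring|].
rewrite Cmult_assoc, IH; ring.
Qed.

(* With [E = q^(d-1)], both sides of the first relation have the termwise
   coefficient [q^-l (1 - A q^(k+l)) + A/E] relative to the series at [q^d]. *)
Lemma Psi1_contiguous_q (A B G E q p x y : C) :
  (0 < Cmod q < 1)%R -> (Cmod p < 1)%R -> (Cmod x < 1)%R ->
  (Cmod y < Cmod q)%R -> E <> 0 ->
  (forall n, 1 - G * p ^ n <> 0) -> (forall n, 1 - E * q ^ n <> 0) ->
  (1 - A) * Psi1 (A * q) B G (E * q) q p x (y / q)
    + A / E * Psi1 A B G (E * q) q p x y
  = Psi1 A B G (E * q) q p x (y / q)
    + A / E * (1 - E) * Psi1 A B G E q p x y.
Proof.
intros hq hp hx hy hE0 hG hE.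
assert (hq0 : q <> 0) by (apply Cmod_gt_0; lra).
assert (hE1 : 1 - E <> 0).
{ specialize (hE O); simpl in hE; now rewrite Cmult_1_r in hE. }
assert (hEq : forall n, 1 - E * q * q ^ n <> 0).
{ intros n; rewrite <- Cmult_assoc; exact (hE (S n)). }
assert (hyq : (Cmod (y / q) < 1)%R).
{ rewrite Cmod_div by exact hq0.
  apply (Rmult_lt_reg_r (Cmod q)); [lra|].
  unfold Rdiv; rewrite Rmult_assoc, Rinv_l; lra. }
(* The coefficient 1 makes the right side a two-term combination as well; both sides are then shown
   to be sums of one double series. *)
rewrite <- (Cmult_1_l (Psi1 A B G (E * q) q p x (y / q))).
eapply is_double_series_unique.
- apply is_double_series_lincomb; apply Psi1_correct; auto; lra.
- eapply is_double_series_ext;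
    [|apply is_double_series_lincomb; apply Psi1_correct; auto; lra].
  intros l k; cbv beta.
  assert (hs := qpoch_shift A q (k + l)).
  assert (hd := qpoch_shift E q k).
  assert (nG := qpoch_neq_0 G p hG l).
  assert (nE := qpoch_neq_0 E q hE k).
  assert (nEq := qpoch_neq_0 (E * q) q hEq k).
  assert (nq := qpoch_neq_0 q q (fun n => one_minus_pow_neq_0 q n (proj2 hq)) k).
  assert (np := qpoch_neq_0 p p (fun n => one_minus_pow_neq_0 p n hp) l).
  assert (nk := hE k).
  assert (nl := Cpow_nz q l hq0).
  assert (hyl : (y / q) ^ l = y ^ l / q ^ l).
  { unfold Cdiv; rewrite Cpow_mult_l, Cpow_inv; auto. }
  rewrite hyl.
  (* The factor [1 - A] is absorbed, so that only [qpoch A q (k + l)] remains as numerator in base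
     [q]. *)
  assert (hs' : (1 - A) * (qpoch (A * q) q (k + l) * qpoch B p l
      / (qpoch G p l * qpoch (E * q) q k * qpoch q q k * qpoch p p l)
      * x ^ k * (y ^ l / q ^ l))
    = (qpoch A q (k + l) * (1 - A * q ^ (k + l))) * qpoch B p l
      / (qpoch G p l * qpoch (E * q) q k * qpoch q q k * qpoch p p l)
      * x ^ k * (y ^ l / q ^ l)).
  { rewrite <- hs; field; auto. }
  rewrite hs'.
  assert (hd' : qpoch (E * q) q k = qpoch E q k * (1 - E * q ^ k) / (1 - E)).
  { rewrite <- hd; field; auto. }
  (* What remains is [q^-l (1 - A q^(k+l)) + A/E = q^-l + (A/E) (1 - E q^k)]. *)
  rewrite hd', Cpow_add_r; field; repeat split; auto.
Qed.

(* With [F = p^(c-1)], both sides have the termwise coefficient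
   [1 - B p^l] relative to the series at [p^b, p^c]. *)
Lemma Psi1_contiguous_p (A B F D q p x y : C) :
  (Cmod q < 1)%R -> (0 < Cmod p < 1)%R -> (Cmod x < 1)%R ->
  (Cmod y < 1)%R -> F <> 0 ->
  (forall n, 1 - F * p ^ n <> 0) -> (forall n, 1 - D * q ^ n <> 0) ->
  (1 - B) * Psi1 A (B * p) (F * p) D q p x y
  = B / F * (1 - F) * Psi1 A B F D q p x y
    + (1 - B / F) * Psi1 A B (F * p) D q p x y.
Proof.
intros hq hp hx hy hF0 hF hD.
assert (hF1 : 1 - F <> 0).
{ specialize (hF O); simpl in hF; now rewrite Cmult_1_r in hF. }
assert (hFp : forall n, 1 - F * p * p ^ n <> 0).
{ intros n; rewrite <- Cmult_assoc; exact (hF (S n)). }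
(* A second term of weight 0 gives the left side the two-term form of [is_double_series_lincomb]. *)
replace ((1 - B) * Psi1 A (B * p) (F * p) D q p x y)
  with ((1 - B) * Psi1 A (B * p) (F * p) D q p x y
        + 0 * Psi1 A (B * p) (F * p) D q p x y) by ring.
eapply is_double_series_unique.
- apply is_double_series_lincomb; apply Psi1_correct; auto; lra.
- eapply is_double_series_ext;
    [|apply is_double_series_lincomb; apply Psi1_correct; auto; lra].
  intros l k; cbv beta.
  assert (hs := qpoch_shift B p l).
  assert (hd := qpoch_shift F p l).
  assert (nF := qpoch_neq_0 F p hF l).
  assert (nFp := qpoch_neq_0 (F * p) p hFp l).
  assert (nD := qpoch_neq_0 D q hD k).
  assert (nq := qpoch_neq_0 q q (fun n => one_minus_pow_neq_0 q n hq) k).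
  assert (np := qpoch_neq_0 p p (fun n => one_minus_pow_neq_0 p n (proj2 hp)) l).
  assert (nl := hF l).
  assert (hs' : (1 - B) * (qpoch A q (k + l) * qpoch (B * p) p l
      / (qpoch (F * p) p l * qpoch D q k * qpoch q q k * qpoch p p l)
      * x ^ k * y ^ l)
    = qpoch A q (k + l) * (qpoch B p l * (1 - B * p ^ l))
      / (qpoch (F * p) p l * qpoch D q k * qpoch q q k * qpoch p p l)
      * x ^ k * y ^ l).
  { rewrite <- hs; field; auto. }
  rewrite hs'.
  assert (hd' : qpoch (F * p) p l = qpoch F p l * (1 - F * p ^ l) / (1 - F)).
  { rewrite <- hd; field; auto. }
  (* What remains is [1 - B p^l = (B/F) (1 - F p^l) + (1 - B/F)]. *)
  rewrite hd'; field; repeat split; auto.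
Qed.

(** * Reduction of the second Humbert function to the first *)

Lemma qpoch_0_l (q : C) (n : nat) : qpoch 0 q n = 1.
Proof.
induction n as [|n IH]; simpl; [reflexivity|rewrite IH; ring].
Qed.

(* [B = 0] makes [(B;p)_l = 1], although [0] is not a power of [p]. *)
Lemma Psi2_Psi1 (A B G q p x y : C) :
  (Cmod q < 1)%R -> (Cmod p < 1)%R -> (Cmod x < 1)%R -> (Cmod y < 1)%R ->
  (forall n, 1 - B * p ^ n <> 0) -> (forall n, 1 - G * q ^ n <> 0) ->
  Psi2 A B G q p x y = Psi1 A 0 B G q p x y.
Proof.
intros hq hp hx hy hB hG.
assert (h : is_double_series (fun l k =>
    qpoch A q (k + l)
    / (qpoch B p l * qpoch G q k * qpoch q q k * qpoch p p l)
    * x ^ k * y ^ l) (Psi1 A 0 B G q p x y)).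
{ eapply is_double_series_ext; [|now apply Psi1_correct].
  intros l k; cbv beta; now rewrite qpoch_0_l, Cmult_1_r. }
apply (is_double_series_unique _ _ _ (double_series_correct _ (ex_intro _ _ h)) h).
Qed.

(** * Complex powers and nonvanishing of denominator factors *)

Lemma Cexp_plus (z w : C) : Cexp (z + w) = Cexp z * Cexp w.
Proof.
destruct z as [a b], w as [c d]; unfold Cexp, Cplus, Cmult, Re, Im; simpl.
rewrite exp_plus, cos_plus, sin_plus; f_equal; ring.
Qed.

Lemma Cexp_0 : Cexp 0 = 1.
Proof.
unfold Cexp, Re, Im; simpl; rewrite exp_0, cos_0, sin_0.
unfold RtoC; f_equal; ring.
Qed.

Lemma cpower_plus (lq a b : C) :
  cpower lq (a + b) = cpower lq a * cpower lq b.
Proof.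
unfold cpower; rewrite <- Cexp_plus; f_equal; ring.
Qed.

Lemma cpower_opp_r (lq a : C) : cpower lq a * cpower lq (- a) = 1.
Proof.
rewrite <- cpower_plus, <- Cexp_0; unfold cpower; f_equal; ring.
Qed.

Lemma cpower_neq_0 (lq a : C) : cpower lq a <> 0.
Proof.
intros h; assert (h1 := cpower_opp_r lq a).
rewrite h, Cmult_0_l in h1; now apply C1_nz.
Qed.

Lemma cpower_1 (lq : C) : cpower lq 1 = Cexp lq.
Proof.
unfold cpower; f_equal; ring.
Qed.

Lemma cpower_minus (lq a b : C) :
  cpower lq (a - b) = cpower lq a / cpower lq b.
Proof.
unfold Cminus; rewrite cpower_plus.
assert (hb := cpower_neq_0 lq b).
replace (cpower lq (- b)) with (cpower lq b * cpower lq (- b) / cpower lq b)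
  by (field; auto).
rewrite cpower_opp_r; field; auto.
Qed.

Lemma one_minus_neq_0 (D q : C) :
  q <> 0 -> (forall n : nat, D <> / q ^ n) -> forall n, 1 - D * q ^ n <> 0.
Proof.
intros hq hD n h; apply (hD n).
assert (hn := Cpow_nz q n hq).
replace D with ((1 - (1 - D * q ^ n)) / q ^ n) by (field; auto).
rewrite h; field; auto.
Qed.

(** Lowering the parameter adds one new factor, [1 - E] at index 0; the factor at [S n] is the old
    one at [n]. *)
Lemma one_minus_pred_neq_0 (E q : C) :
  E <> 1 -> (forall n, 1 - E * q * q ^ n <> 0) -> forall n, 1 - E * q ^ n <> 0.
Proof.
intros hE hEq [|n].
- simpl; rewrite Cmult_1_r; intros h; apply hE.
  replace E with (1 - (1 - E)) by ring; rewrite h; ring.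
- specialize (hEq n); now rewrite <- Cmult_assoc in hEq.
Qed.

(** * The relations for complex exponents *)

Theorem theorem2p3 (q p lq lp x : C)
  (hq : (0 < Cmod q < 1)%R) (hp : (0 < Cmod p < 1)%R)
  (hlq : Cexp lq = q) (hlp : Cexp lp = p)
  (hx : (Cmod x < 1)%R) :
  (forall a b c d : C,
     (forall n : nat, cpower lp c <> / p ^ n) ->
     (forall n : nat, cpower lq d <> / q ^ n) ->
     (forall y : C, (Cmod y < Cmod q)%R -> cpower lq (d - 1) <> 1 ->
        (1 - cpower lq a)
          * Psi1 (cpower lq (a + 1)) (cpower lp b) (cpower lp c) (cpower lq d)
                 q p x (y / q)
        + cpower lq (a + 1 - d)
          * Psi1 (cpower lq a) (cpower lp b) (cpower lp c) (cpower lq d)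
                 q p x y
        = Psi1 (cpower lq a) (cpower lp b) (cpower lp c) (cpower lq d)
               q p x (y / q)
        + cpower lq (a + 1 - d) * (1 - cpower lq (d - 1))
          * Psi1 (cpower lq a) (cpower lp b) (cpower lp c) (cpower lq (d - 1))
                 q p x y)
     /\
     (forall y : C, (Cmod y < 1)%R -> cpower lp (c - 1) <> 1 ->
        (1 - cpower lp b)
          * Psi1 (cpower lq a) (cpower lp (b + 1)) (cpower lp c) (cpower lq d)
                 q p x y
        = cpower lp (b + 1 - c) * (1 - cpower lp (c - 1))
          * Psi1 (cpower lq a) (cpower lp b) (cpower lp (c - 1)) (cpower lq d)
                 q p x y
        + (1 - cpower lp (b + 1 - c))
          * Psi1 (cpower lq a) (cpower lp b) (cpower lp c) (cpower lq d)
                 q p x y))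
  /\
  (forall a b c : C,
     (forall n : nat, cpower lp b <> / p ^ n) ->
     (forall n : nat, cpower lq c <> / q ^ n) ->
     forall y : C, (Cmod y < Cmod q)%R -> cpower lq (c - 1) <> 1 ->
       (1 - cpower lq a)
         * Psi2 (cpower lq (a + 1)) (cpower lp b) (cpower lq c)
                q p x (y / q)
       + cpower lq (a + 1 - c)
         * Psi2 (cpower lq a) (cpower lp b) (cpower lq c) q p x y
       = Psi2 (cpower lq a) (cpower lp b) (cpower lq c) q p x (y / q)
       + cpower lq (a + 1 - c) * (1 - cpower lq (c - 1))
         * Psi2 (cpower lq a) (cpower lp b) (cpower lq (c - 1)) q p x y).
Proof.
assert (hq0 : q <> 0) by (apply Cmod_gt_0; lra).
assert (hp0 : p <> 0) by (apply Cmod_gt_0; lra).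
assert (hqS : forall a, cpower lq (a + 1) = cpower lq a * q).
{ intros a; now rewrite cpower_plus, cpower_1, hlq. }
assert (hpS : forall a, cpower lp (a + 1) = cpower lp a * p).
{ intros a; now rewrite cpower_plus, cpower_1, hlp. }
(* Everything is expressed through [E = q^(d-1)]: then [q^d = E q] and [q^(a+1-d) = q^a / E],
   matching the parameter form of the relations; likewise in base [p]. *)
assert (hqP : forall d, cpower lq d = cpower lq (d - 1) * q).
{ intros d; rewrite <- hqS; f_equal; ring. }
assert (hpP : forall d, cpower lp d = cpower lp (d - 1) * p).
{ intros d; rewrite <- hpS; f_equal; ring. }
assert (hqM : forall a d, cpower lq (a + 1 - d) = cpower lq a / cpower lq (d - 1)).
{ intros a d; rewrite <- cpower_minus; f_equal; ring. }
assert (hpM : forall a d, cpower lp (a + 1 - d) = cpower lp a / cpower lp (d - 1)).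
{ intros a d; rewrite <- cpower_minus; f_equal; ring. }
assert (hqE : forall d, (forall n : nat, cpower lq d <> / q ^ n) ->
  cpower lq (d - 1) <> 1 -> forall n, 1 - cpower lq (d - 1) * q ^ n <> 0).
{ intros d hd hd1; apply one_minus_pred_neq_0; [exact hd1|].
  rewrite <- hqP; now apply one_minus_neq_0. }
assert (hpE : forall d, (forall n : nat, cpower lp d <> / p ^ n) ->
  cpower lp (d - 1) <> 1 -> forall n, 1 - cpower lp (d - 1) * p ^ n <> 0).
{ intros d hd hd1; apply one_minus_pred_neq_0; [exact hd1|].
  rewrite <- hpP; now apply one_minus_neq_0. }
split; [intros a b c d hc hd; split|intros a b c hb hc]; intros y hy h1.
- rewrite hqS, hqM, (hqP d).
  apply Psi1_contiguous_q; auto; try lra; try apply cpower_neq_0.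
  now apply one_minus_neq_0.
- rewrite hpS, hpM, (hpP c).
  apply Psi1_contiguous_p; auto; try lra; try apply cpower_neq_0.
  now apply one_minus_neq_0.
- assert (hyq : (Cmod (y / q) < 1)%R).
  { rewrite Cmod_div by exact hq0.
    apply (Rmult_lt_reg_r (Cmod q)); [lra|].
    unfold Rdiv; rewrite Rmult_assoc, Rinv_l; lra. }
  assert (hB := one_minus_neq_0 _ _ hp0 hb).
  assert (hC := one_minus_neq_0 _ _ hq0 hc).
  assert (hE := hqE c hc h1).
  (* All four [Psi2] values become [Psi1] with second parameter 0, so (II) is the first relation of
     (I) at [B = 0]. That relation is available because it was proved for arbitrary [B], not only
     for powers of [p]. *)
  rewrite !Psi2_Psi1 by (auto; lra).
  rewrite hqS, hqM, (hqP c).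
  apply Psi1_contiguous_q; auto; try lra; apply cpower_neq_0.
Qed.
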